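(* Let $p\ge 2$, let $h$ be an integer greater than $1$, let $k\in \{1,\ldots,p-1\}$, let $\prec$ be a monomial order on $\mathbb{N}^p$ such that every element of $\mathbb{N}^p$ is preceded by only finitely many elements, and let $S\subset \mathbb{N}^p$ be the semigroup minimally generated by $$\{e_1,\ldots ,e_{p-1},2e_p,3e_p,e_p+he_k\}\cup \{e_p+e_i \mid i\in\{1,\ldots,p-1\}\setminus \{k\}\}.$$ Then the $\mathbb{N}^p$-semigroup $S$ satisfies the extended Wilf's conjecture (with respect to $\prec$), that is, $\mathrm{n}(S)\cdot \mathrm{e}(S)\geq \mathcal{N}(\mathrm{Fb}(S))+1$.
   Context: $\mathbb{N}$ is the set of nonnegative integers and $\{e_1,\ldots,e_p\}$ is the standard basis of $\mathbb{N}^p$. An affine semigroup is a finitely generated submonoid of $(\mathbb{N}^p,+)$; it has a unique minimal generating set (as a monoid), whose cardinality is its embedding dimension $\mathrm{e}(S)$. An $\mathbb{N}^p$-semigroup is an affine semigroup $S\subset\mathbb{N}^p$ such that $\mathcal{H}(S)=\mathbb{N}^p\setminus S$ is finite. A monomial order $\prec$ on $\mathbb{N}^p$ is a total order such that $a\preceq b$ implies $a+c\preceq b+c$ for all $c\in\mathbb{N}^p$, and $0\preceq c$ for all $c\in\mathbb{N}^p$. The genus is $\mathrm{g}(S)=|\mathcal{H}(S)|$; the Frobenius element $\mathrm{Fb}(S)$ is the maximum of $\mathcal{H}(S)$ with respect to $\prec$ (with the convention $\mathrm{Fb}(\mathbb{N}^p)=(-1,\ldots,-1)$, preceding all elements of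 $\mathbb{N}^p$); $\mathrm{n}(S)$ is the cardinality of $\{x\in S\mid x\prec \mathrm{Fb}(S)\}$; and the Frobenius number is $\mathcal{N}(\mathrm{Fb}(S))=\mathrm{n}(S)+\mathrm{g}(S)-1$. Thus the extended Wilf inequality reads $\mathrm{n}(S)\,\mathrm{e}(S)\ge \mathrm{n}(S)+\mathrm{g}(S)$. *)

(* Defs.v *)
From HB Require Import structures.
From mathcomp Require Import all_boot all_order all_algebra finmap.
From mathcomp Require Import boolp classical_sets functions cardinality.

Set Implicit Arguments.
Unset Strict Implicit.
Unset Printing Implicit Defensive.
Import Order.TTheory GRing.Theory Num.Theory.
Local Open Scope classical_set_scope.
Local Open Scope ring_scope.

Section AffineSemigroups.
Variable p : nat.
Local Notation Np := 'rV[nat]_p.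
Implicit Types (x y : Np) (A B S : set Np) (le : rel Np).

(* 1-based: [e_ 1], ..., [e_ p] is the standard basis of N^p. *)
Definition e_ (i : nat) : Np := \row_(j < p) nat_of_bool (j.+1 == i).

Definition submonoid S := S 0 /\ forall x y, S x -> S y -> S (x + y).

Definition monoid_span A : set Np := smallest submonoid A.

Definition minimally_generated S A :=
  monoid_span A = S /\
  forall B, B `<=` A -> monoid_span B = S -> B = A.

Definition affine_semigroup S :=
  exists2 A, finite_set A & monoid_span A = S.

Definition gaps S : set Np := ~` S.

Definition Np_semigroup S := affine_semigroup S /\ finite_set (gaps S).

Definition card A : nat := #|` fset_set A|%fset.

(* An affine semigroup has exactly one minimal generating set, so the choice
   made by [xget] is immaterial. *)
Definition embdim S : nat := card (xget set0 (minimally_generated S)).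

Record monomial_order le : Prop := MonomialOrder {
  monomial_order_anti : antisymmetric le;
  monomial_order_trans : transitive le;
  monomial_order_total : total le;
  monomial_order_add : forall a b c, le a b -> le (a + c) (b + c);
  monomial_order_ge0 : forall c, le 0 c }.

Definition prec le x y := (x != y) && le x y.

Definition finite_below le := forall x, finite_set [set y | prec le y x].

Definition genus S : nat := card (gaps S).

Definition is_maximum le A x := A x /\ forall y, A y -> le y x.

Definition to_Zp x : 'rV[int]_p := map_mx Posz x.

(* The default value (-1, ..., -1) is taken exactly when [gaps S] has no
   maximum; when [gaps S] is finite this means S = N^p. *)
Definition Fb le S : 'rV[int]_p :=
  xget (const_mx (-1)) (to_Zp @` is_maximum le (gaps S)).

(* The order extended to N^p with (-1, ..., -1) added as least element:
   no element of N^p precedes (-1, ..., -1). *)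
Definition prec_ext le x (f : 'rV[int]_p) :=
  exists2 y, f = to_Zp y & prec le x y.

Definition nsmall le S : nat := card [set x | S x /\ prec_ext le x (Fb le S)].

(* Integer-valued, since it is -1 for S = N^p. *)
Definition Frobenius_number le S : int :=
  (nsmall le S)%:Z + (genus S)%:Z - 1.

Definition extended_Wilf le S :=
  Frobenius_number le S + 1 <= (nsmall le S * embdim S)%:Z.

Definition generators (h k : nat) : set Np :=
  [set e_ i | i in [set i : nat | (1 <= i <= p - 1)%N]]
  `|` [set e_ p *+ 2; e_ p *+ 3; e_ p + e_ k *+ h]
  `|` [set e_ p + e_ i | i in [set i : nat | (1 <= i <= p - 1)%N && (i != k)]].

End AffineSemigroups.

Arguments e_ : clear implicits.
Arguments generators : clear implicits.

(* Main.v *)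
(* [S] is the complement of the [h] gaps [e_p + j e_k], [0 <= j < h], so its
   Frobenius element is [e_p + (h-1) e_k] for every monomial order.  The [h]
   elements [j e_k] of [S] precede it, whence [g(S) <= n(S)], and two
   generators already give [n(S) e(S) >= 2 n(S) >= n(S) + g(S)].  The generators
   are irreducible in [S], hence contained in every generating set; this yields
   minimality and identifies [e(S)]. *)

Require Import Defs.
From mathcomp Require Import all_boot all_order all_algebra finmap zify.
From mathcomp Require Import boolp classical_sets functions cardinality.

Set Implicit Arguments.
Unset Strict Implicit.
Unset Printing Implicit Defensive.
Import Order.TTheory GRing.Theory Num.Theory.
Local Open Scope classical_set_scope.
Local Open Scope ring_scope.

(** * Irreducible elements and minimal generating sets *)

Definition irreducible_in (p : nat) (S : set 'rV[nat]_p) : set 'rV[nat]_p :=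
  [set a | [/\ S a, a <> 0 &
      forall x y, S x -> S y -> x + y = a -> x = 0 \/ y = 0]].

Definition axis_gaps (p h k : nat) : set 'rV[nat]_p :=
  [set e_ p p + e_ p k *+ j | j in `I_h].
Arguments axis_gaps : clear implicits.

Lemma monoid_span_submonoid (p : nat) (A : set 'rV[nat]_p) :
  submonoid (monoid_span A).
Proof.
split=> [B [[B0 _] _] //|x y Ax Ay B AB].
by case: (AB) => -[_ addB] _; apply: addB; [apply: Ax | apply: Ay].
Qed.

Lemma submonoid_natmul (p : nat) (S : set 'rV[nat]_p) x m :
  submonoid S -> S x -> S (x *+ m).
Proof.
move=> [S0 addS] Sx; elim: m => [|m IHm]; first by rewrite mulr0n.
by rewrite mulrS; apply: addS.
Qed.

Lemma submonoid_sum (p : nat) (S : set 'rV[nat]_p) (I : Type) (r : seq I) F :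
  submonoid S -> (forall i, S (F i)) -> S (\sum_(i <- r) F i).
Proof. by move=> [S0 addS] SF; apply: big_ind. Qed.

(* Removing an irreducible element leaves a submonoid. *)
Lemma irreducible_in_generators (p : nat) (S A : set 'rV[nat]_p) a :
  monoid_span A = S -> irreducible_in S a -> A a.
Proof.
move=> defS [Sa a0 irr_a]; apply: contrapT => nAa.
have [S0 addS] : submonoid S by rewrite -defS; exact: monoid_span_submonoid.
have subS : A `<=` S by rewrite -defS; exact: sub_smallest.
suff: [set x | S x /\ x <> a] a by case.
move: (Sa); rewrite -{1}defS; apply; split; last first.
  by move=> x Ax; split; [exact: subS | move=> xa; rewrite xa in Ax].
split=> [|x y [Sx xa] [Sy ya]]; first by split=> // /esym.
split; first exact: addS.
move=> xya; case: (irr_a x y Sx Sy xya) => z0; move: xya; rewrite z0.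
  by rewrite add0r.
by rewrite addr0.
Qed.

(** A generating subset of [A] must contain every irreducible element of [S], hence all of [A]. *)
Lemma minimally_generated_irreducible (p : nat) (S A : set 'rV[nat]_p) :
  monoid_span A = S -> A `<=` irreducible_in S -> minimally_generated S A.
Proof.
move=> defS irrA; split=> // B BA defB; apply/seteqP; split=> // a Aa.
exact: irreducible_in_generators defB (irrA a Aa).
Qed.

(** The set chosen by [xget] generates [S], so it contains the irreducible elements in [A]; its own
    minimality then forces it to equal [A]. *)
Lemma embdim_irreducible (p : nat) (S A : set 'rV[nat]_p) :
  monoid_span A = S -> A `<=` irreducible_in S -> embdim S = Defs.card A.
Proof.
move=> defS irrA; rewrite /embdim; congr Defs.card.
have minA := minimally_generated_irreducible defS irrA.
have [defB minB] := xgetPex set0 (ex_intro _ A minA).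
symmetry; apply: minB => // a Aa.
exact: irreducible_in_generators defB (irrA a Aa).
Qed.

(** * Coordinate computations *)

Lemma addrvE (p : nat) (x y : 'rV[nat]_p) j :
  (x + y) 0%R j = (x 0%R j + y 0%R j)%N.
Proof. by rewrite mxE. Qed.

Lemma rv0E (p : nat) j : (0 : 'rV[nat]_p) 0%R j = 0%N.
Proof. by rewrite mxE. Qed.

Lemma e_E (p i : nat) j : e_ p i 0%R j = (j.+1 == i).
Proof. by rewrite mxE. Qed.

Lemma e_natmulE (p i m : nat) j : (e_ p i *+ m) 0%R j = ((j.+1 == i) * m)%N.
Proof.
elim: m => [|m IHm]; first by rewrite mulr0n rv0E muln0.
by rewrite mulrS addrvE IHm e_E mulnS.
Qed.

Definition rvE := (addrvE, rv0E, e_natmulE, e_E).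

Ltac rv_lia := rewrite ?rvE /=; repeat case: eqP => ?; lia.

(** Subtraction of naturals truncates at 0; the coordinatewise bound makes it exact. *)
Lemma rv_subK (p : nat) (x y : 'rV[nat]_p) :
  (forall j, x 0%R j <= y 0%R j)%N -> x + \row_j (y 0%R j - x 0%R j)%N = y.
Proof. by move=> xy; apply/rowP => j; rewrite addrvE mxE subnKC. Qed.

Lemma rv_sum_e (p : nat) (x : 'rV[nat]_p) :
  x = \sum_(j < p) e_ p j.+1 *+ x 0%R j.
Proof.
apply/rowP => i; rewrite summxE (bigD1 i) //= big1 => [|j ji].
  by rewrite rvE eqxx addr0 mul1n.
by rewrite rvE eqSS (_ : (i == j :> nat) = false) // eq_sym; apply/negbTE.
Qed.

(** * The set of gaps and the semigroup spanned by the generators *)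

Lemma axis_gapsP (n h : nat) (k : 'I_n.+1) (x : 'rV[nat]_n.+1) :
  (k < n)%N ->
  axis_gaps n.+1 h k.+1 x <->
  [/\ x 0%R ord_max = 1%N, (x 0%R k < h)%N &
      forall j : 'I_n.+1, (j < n)%N -> j <> k :> nat -> x 0%R j = 0%N].
Proof.
move=> kn; split=> [[m /= mh <-]|[xl xk x0]].
  split=> [||j jn jk]; rv_lia.
exists (x 0%R k) => //; apply/rowP => j; rewrite !rvE.
have [jn|jn] := ltnP j n; last first.
  have -> : j = ord_max by apply: val_inj => /=; have := ltn_ord j; lia.
  by rewrite /= xl; lia.
have [->|/eqP jk] := eqVneq j k; first by rv_lia.
have jk' : j <> k :> nat by move=> /val_inj.
by rewrite (x0 j) //; lia.
Qed.

(** If [x + y] is a gap, its last coordinate 1 comes from one summand; the other coordinates of that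
    summand are bounded by those of the gap, so it is a gap itself. *)
Lemma axis_gapsC_submonoid (n h : nat) (k : 'I_n.+1) :
  (k < n)%N -> submonoid (~` axis_gaps n.+1 h k.+1).
Proof.
move=> kn; split=> [/(axis_gapsP _ _ kn) []|x y nx ny /(axis_gapsP _ _ kn)].
  by rewrite rv0E.
rewrite !addrvE => -[xyl xyk xy0].
have [xl|xl] : x 0%R ord_max = 1%N \/ y 0%R ord_max = 1%N by lia.
  apply: nx; apply/(axis_gapsP _ _ kn); split=> // [|j jn jk]; first by lia.
  by have := xy0 j jn jk; rv_lia.
apply: ny; apply/(axis_gapsP _ _ kn); split=> // [|j jn jk]; first by lia.
by have := xy0 j jn jk; rv_lia.
Qed.

(** Such an [x] dominates coordinatewise a generator with last coordinate 1: either [e_p + h e_k] or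
    some [e_p + e_i] with [i <> k]. *)
Lemma axis_gapsC_last1 (n h : nat) (k : 'I_n.+1) (x : 'rV[nat]_n.+1) :
  (k < n)%N -> ~ axis_gaps n.+1 h k.+1 x -> x 0%R ord_max = 1%N ->
  (h <= x 0%R k)%N \/
  exists j : 'I_n.+1, [/\ (j < n)%N, j <> k :> nat & (0 < x 0%R j)%N].
Proof.
move=> kn nx xl; apply: contrapT => /not_orP [xk x0]; apply: nx.
apply/(axis_gapsP _ _ kn); split=> // [|j jn jk]; first by lia.
by apply: contrapT => xj; apply: x0; exists j; split=> //; lia.
Qed.

(** No generator is a gap and the non-gaps form a submonoid. Conversely, a non-gap is decomposed
    according to its last coordinate: 0, 1 or at least 2. *)
Lemma generators_span (n h : nat) (k : 'I_n.+1) :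
  (k < n)%N -> (1 < h)%N ->
  monoid_span (generators n.+1 h k.+1) = ~` axis_gaps n.+1 h k.+1.
Proof.
move=> kn h1; apply/seteqP; split.
  apply: smallest_sub; first exact: axis_gapsC_submonoid.
  move=> x Gx /(axis_gapsP _ _ kn) [xl xk x0].
  case: Gx xl xk x0 => [[[i /= iP <-]|[[->|->]|->]]|[i /= iP <-]].
  - rv_lia.
  - rv_lia.
  - rv_lia.
  - rv_lia.
  - move=> _ _ x0; have iO : (i.-1 < n.+1)%N by lia.
    have := x0 (Ordinal iO); rv_lia.
have monS := monoid_span_submonoid (generators n.+1 h k.+1).
have GS : generators n.+1 h k.+1 `<=` monoid_span (generators n.+1 h k.+1).
  exact: sub_smallest.
set S := monoid_span _ in monS GS *; have [S0 addS] := monS.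
have S_last0 (y : 'rV[nat]_n.+1) : y 0%R ord_max = 0%N -> S y.
  move=> yl; rewrite [y]rv_sum_e; apply: (submonoid_sum _ monS) => j.
  have [jn|jn] := ltnP j n.
    apply: (submonoid_natmul _ monS); apply: GS; left; left.
    exists j.+1 => //=; lia.
  have -> : j = ord_max by apply: val_inj => /=; have := ltn_ord j; lia.
  by rewrite yl mulr0n.
(* The remainder [x - g] has last coordinate 0, so it is a sum of vectors [e_i] with [i < p]. *)
have S_le (g x : 'rV[nat]_n.+1) : S g -> (forall j, g 0%R j <= x 0%R j)%N ->
    g 0%R ord_max = x 0%R ord_max -> S x.
  move=> Sg gx gl; rewrite -(rv_subK gx); apply: addS => //.
  by apply: S_last0; rewrite mxE gl subnn.
have S2 : S (e_ n.+1 n.+1 *+ 2) by apply: GS; left; right; left; left.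
have S3 : S (e_ n.+1 n.+1 *+ 3) by apply: GS; left; right; left; right.
have last_ord (j : 'I_n.+1) : j.+1 = n.+1 -> j = ord_max.
  by move=> [jn]; apply: val_inj.
move=> x nx; have [xl|xl] := ltnP (x 0%R ord_max) 2; last first.
  apply: (S_le (e_ n.+1 n.+1 *+ x 0%R ord_max)).
  - set m := x 0%R ord_max in xl *.
    (* A sum of 2s with one 3 when [m] is odd; the truncated difference is exact because an odd
       [m >= 2] has [m./2 >= 1]. *)
    rewrite (_ : m = 3 * odd m + 2 * (m./2 - odd m))%N; last by lia.
    by rewrite mulrnDr !mulrnA; apply: addS; apply: (submonoid_natmul _ monS).
  - move=> j; rewrite !rvE; case: eqP => [/last_ord ->|_]; lia.
  - by rv_lia.
have [xl0|{}xl] : x 0%R ord_max = 0%N \/ x 0%R ord_max = 1%N by lia.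
  exact: S_last0.
have [xk|[i [jn jk xi]]] := axis_gapsC_last1 kn nx xl.
  apply: (S_le (e_ n.+1 n.+1 + e_ n.+1 k.+1 *+ h)).
  - by apply: GS; left; right; right.
  - move=> j; rewrite !rvE; case: eqP => [/last_ord ->|jn] /=; first by lia.
    by case: eqP => [[/val_inj ->]|_]; lia.
  - by rv_lia.
apply: (S_le (e_ n.+1 n.+1 + e_ n.+1 i.+1)).
- by apply: GS; right; exists i.+1 => //=; lia.
- move=> j; rewrite !rvE; case: eqP => [/last_ord ->|jn'] /=; first by lia.
  by case: eqP => [[/val_inj ->]|_]; lia.
- by rv_lia.
Qed.

(** * Irreducibility of the generators *)

Lemma generators_irreducible (n h : nat) (k : 'I_n.+1) :
  (k < n)%N -> (1 < h)%N ->
  generators n.+1 h k.+1 `<=` irreducible_in (~` axis_gaps n.+1 h k.+1).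
Proof.
move=> kn h1 g Gg.
(* The summand [x] dominates a generator with last coordinate 1. Comparing coordinates, this can
   only be the generator being split, so nothing is left for [y]. *)
have irr_last1 (x y : 'rV[nat]_n.+1) :
    ~ axis_gaps n.+1 h k.+1 x -> x 0%R ord_max = 1%N ->
    (e_ n.+1 n.+1 + e_ n.+1 k.+1 *+ h = x + y \/
     exists2 i, i <> k.+1 & e_ n.+1 n.+1 + e_ n.+1 i = x + y) -> y = 0.
  move=> nx xl [|[i ik]] /rowP gxy; apply/rowP => j; move: (gxy j);
    case: (axis_gapsC_last1 kn nx xl) => [xk|[m [mn mk xm]]].
  - have := gxy k; have := gxy ord_max; rewrite !rvE /=.
    have [<-|jk] := eqVneq k j; first by lia.
    have [jn|jn] := eqVneq j ord_max; first by rewrite jn; lia.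
    move: jk jn; rewrite -!val_eqE /=; lia.
  - have := gxy m; rv_lia.
  - have := gxy k; rv_lia.
  - have := gxy m; have := gxy ord_max; rewrite !rvE /=.
    have [<-|jk] := eqVneq m j; first by lia.
    have [jn|jn] := eqVneq j ord_max; first by rewrite jn; lia.
    move: jk jn; rewrite -!val_eqE /=; lia.
(* The vector [e_p] is itself a gap, the one with [j = 0]. *)
have irr_last (x : 'rV[nat]_n.+1) m :
    x = e_ n.+1 n.+1 *+ m -> ~ axis_gaps n.+1 h k.+1 x -> m <> 1%N.
  move=> -> nx m1; apply: nx; rewrite m1 mulr1n; exists 0%N => /=; first lia.
  by rewrite mulr0n addr0.
split.
- by rewrite -generators_span //; move: g Gg; exact: sub_smallest.
- move=> /rowP g0; move: Gg g0.
  case=> [[[i /= iP <-]|[[->|->]|->]]|[i /= iP <-]] g0;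
   try by have := g0 ord_max; rv_lia.
  have iO : (i.-1 < n.+1)%N by lia.
  by have := g0 (Ordinal iO); rv_lia.
move=> x y nx ny xyg.
(* Exactly one summand has last coordinate 1; by commutativity it may be taken first. *)
have irr_1 :
    (forall x y : 'rV[nat]_n.+1, ~ axis_gaps n.+1 h k.+1 x ->
       x 0%R ord_max = 1%N -> x + y = g -> y = 0) ->
    g 0%R ord_max = 1%N -> x = 0 \/ y = 0.
  move=> irr gl; move: gl; rewrite -xyg addrvE => gl.
  have [xl|yl] : x 0%R ord_max = 1%N \/ y 0%R ord_max = 1%N by lia.
    by right; apply: (irr x).
  by left; apply: (irr y) => //; rewrite addrC.
(* Both summands are multiples of [e_p] with coefficient different from 1, and neither 2 nor 3 is a
   sum of two integers that are at least 2. *)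
have irr_m m : m = 2%N \/ m = 3%N -> g = e_ n.+1 n.+1 *+ m -> x = 0 \/ y = 0.
  move=> m23 gm; move: xyg; rewrite gm => /rowP xyg.
  have coord (z : 'rV[nat]_n.+1) :
      (forall j, z 0%R j <= (e_ n.+1 n.+1 *+ m) 0%R j)%N ->
      z = e_ n.+1 n.+1 *+ z 0%R ord_max.
    move=> zm; apply/rowP => j; have := zm j; rewrite !rvE.
    case: eqP => [[jn]|_]; last by lia.
    have -> : j = ord_max by apply: val_inj.
    by rewrite !mul1n.
  have xe : x = e_ n.+1 n.+1 *+ x 0%R ord_max.
    by apply: coord => j; rewrite -xyg addrvE leq_addr.
  have ye : y = e_ n.+1 n.+1 *+ y 0%R ord_max.
    by apply: coord => j; rewrite -xyg addrvE leq_addl.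
  have x1 := irr_last _ _ xe nx; have y1 := irr_last _ _ ye ny.
  have [xl|yl] : x 0%R ord_max = 0%N \/ y 0%R ord_max = 0%N.
    by have := xyg ord_max; rv_lia.
  - by left; rewrite xe xl mulr0n.
  - by right; rewrite ye yl mulr0n.
case: Gg => [[[i /= iP gE]|[[gE|gE]|gE]]|[i /= /andP[iP /eqP ik] gE]].
- have iO : (i.-1 < n.+1)%N by lia.
  have xyE j : (x 0%R j + y 0%R j = (j.+1 == i))%N.
    by rewrite -addrvE xyg -gE e_E.
  have [xi|yi] : x 0%R (Ordinal iO) = 0%N \/ y 0%R (Ordinal iO) = 0%N.
    by have := xyE (Ordinal iO); lia.
  + left; apply/rowP => j; have := xyE j; rewrite rv0E.
    have [->|] := eqVneq j (Ordinal iO); first by lia.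
    rewrite -val_eqE /=; lia.
  + right; apply/rowP => j; have := xyE j; rewrite rv0E.
    have [->|] := eqVneq j (Ordinal iO); first by lia.
    rewrite -val_eqE /=; lia.
- by apply: (irr_m 2) => //; left.
- by apply: (irr_m 3) => //; right.
- apply: irr_1 => [u v nu ul uv|]; last by rewrite gE; rv_lia.
  by apply: (irr_last1 u) => //; left; rewrite uv.
- apply: irr_1 => [u v nu ul uv|]; last by rewrite -gE; rv_lia.
  by apply: (irr_last1 u) => //; right; exists i => //; rewrite uv.
Qed.

(** * Finiteness and cardinalities *)

Lemma finite_generators (p h k : nat) : finite_set (generators p h k).
Proof.
have finI : finite_set [set i : nat | (1 <= i <= p - 1)%N].
  by apply: (sub_finite_set _ (finite_II p)) => i /=; lia.
rewrite /generators !finite_setU; repeat split=> //;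
  try exact: finite_set1; apply: finite_image => //.
by apply: (sub_finite_set _ finI) => i /= /andP[].
Qed.

(** Finiteness of [B] matters: [fset_set] sends an infinite set to the empty one, so its [card] is
    0. *)
Lemma card_le (p : nat) (A B : set 'rV[nat]_p) :
  finite_set B -> A `<=` B -> (Defs.card A <= Defs.card B)%N.
Proof.
move=> finB AB; apply: fsubset_leq_card; rewrite -fset_set_sub //.
exact: sub_finite_set finB.
Qed.

Lemma card_image_I (p m : nat) (f : nat -> 'rV[nat]_p) :
  injective f -> Defs.card [set f i | i in `I_m] = m.
Proof.
move=> f_inj; apply: card_fset_set; apply: inj_card_eq.
by move=> i j _ _; exact: f_inj.
Qed.

(** * Monomial orders and the Frobenius element *)

Lemma le_add_monomial (p : nat) (le : rel 'rV[nat]_p) x y z :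
  monomial_order le -> le x y -> le x (y + z).
Proof.
move=> leM xy; apply: (monomial_order_trans leM xy).
have := monomial_order_add leM y (monomial_order_ge0 leM z).
by rewrite add0r addrC.
Qed.

(** By antisymmetry the maximum is unique, so [xget] returns it and not its default value. *)
Lemma Fb_max (p : nat) (le : rel 'rV[nat]_p) (S : set 'rV[nat]_p) f :
  monomial_order le -> is_maximum le (gaps S) f -> Fb le S = to_Zp f.
Proof.
move=> leM maxf; apply: xget_unique; first by exists f.
move=> _ [g maxg <-]; congr to_Zp; apply: (monomial_order_anti leM).
by rewrite maxf.2 ?maxg.2 //; [case: maxf | case: maxg].
Qed.

Lemma nsmall_max (p : nat) (le : rel 'rV[nat]_p) (S : set 'rV[nat]_p) f :
  monomial_order le -> is_maximum le (gaps S) f ->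
  nsmall le S = Defs.card [set x | S x /\ prec le x f].
Proof.
move=> leM maxf; rewrite /nsmall (Fb_max leM maxf); congr Defs.card.
apply/seteqP; split=> x [Sx xf]; split=> //; last by exists f.
(* The embedding [to_Zp] is injective. *)
case: xf => y fy xy; suff -> : f = y by [].
by apply/rowP => j; move/rowP: fy => /(_ j); rewrite !mxE => -[].
Qed.

Theorem lemma11 (p h k : nat) (le : rel 'rV[nat]_p) (S : set 'rV[nat]_p)
  (hp : (2 <= p)%N) (hh : (1 < h)%N) (hk : (1 <= k <= p - 1)%N)
  (le_monomial : monomial_order le) (le_finite : finite_below le)
  (S_gen : S = monoid_span (generators p h k)) :
  [/\ minimally_generated S (generators p h k),
      Np_semigroup S &
      extended_Wilf le S].
Proof.
(* With [p = n + 1], [ord_max] indexes the coordinate of [e_p]; [k] is shifted because [e_] counts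
   from 1 and ordinals from 0. *)
case: p => [//|n] in le S hp hk le_monomial le_finite S_gen *.
case: k => [//|k0] in hk S_gen *.
have kO : (k0 < n.+1)%N by lia.
pose k := Ordinal kO; have kn : (k < n)%N by rewrite /=; lia.
have irrG := @generators_irreducible n h k kn hh.
have defG := @generators_span n h k kn hh.
have SE : S = ~` axis_gaps n.+1 h k.+1 by rewrite S_gen.
rewrite -SE in irrG defG.
have gapsE : gaps S = axis_gaps n.+1 h k.+1 by rewrite /gaps SE setCK.
have e_natmul_inj : injective (fun j => e_ n.+1 k.+1 *+ j).
  by move=> i j /rowP /(_ k); rv_lia.
have fin_gaps : finite_set (gaps S) by rewrite gapsE; exact: finite_image.
split.
- exact: minimally_generated_irreducible.
- split=> //; exists (generators n.+1 h k.+1) => //.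
  exact: finite_generators.
set f := e_ n.+1 n.+1 + e_ n.+1 k.+1 *+ h.-1.
have e_mono i j : (i <= j)%N -> le (e_ n.+1 k.+1 *+ i) (e_ n.+1 k.+1 *+ j).
  move=> ij; rewrite -(subnKC ij) mulrnDr; apply: le_add_monomial => //.
  (* Totality applied to a single vector gives reflexivity. *)
  have := monomial_order_total le_monomial (e_ n.+1 k.+1 *+ i).
  by move=> /(_ (e_ n.+1 k.+1 *+ i)); rewrite orbb.
have max_f : is_maximum le (gaps S) f.
  rewrite gapsE; split; first by exists h.-1 => //=; lia.
  move=> _ [j /= jh <-]; rewrite /f ![e_ n.+1 n.+1 + _]addrC.
  by apply: monomial_order_add => //; apply: e_mono; lia.
have genusE : genus S = h.
  by rewrite /genus gapsE; apply: card_image_I => i j /rowP /(_ k); rv_lia.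
have le_n : (h <= nsmall le S)%N.
  rewrite (nsmall_max le_monomial max_f).
  rewrite -[X in (X <= _)%N](card_image_I h e_natmul_inj).
  apply: card_le.
    (* Only finitely many elements precede [f], so [card] truly counts them. *)
    by apply: (sub_finite_set _ (le_finite f)) => x [].
  move=> _ [j /= jh <-]; split.
    by rewrite SE => /(axis_gapsP _ _ kn) []; rv_lia.
  apply/andP; split.
    (* The last coordinate is 0 for [j e_k] and 1 for [f]. *)
    by apply/eqP => /rowP /(_ ord_max); rv_lia.
  by rewrite /f addrC; apply: le_add_monomial => //; apply: e_mono; lia.
have le_e : (2 <= embdim S)%N.
  rewrite (embdim_irreducible defG irrG).
  (* The values at 0 and 1 are the two generators [2 e_p] and [3 e_p]. *)
  have inj2 : injective (fun i => e_ n.+1 n.+1 *+ (i + 2)).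
    by move=> i j /rowP /(_ ord_max); rv_lia.
  rewrite -[X in (X <= _)%N](card_image_I 2 inj2); apply: card_le.
    exact: finite_generators.
  by move=> _ [[|[|//]] /= _ <-]; left; right; left; [left | right].
(* The terms -1 and +1 cancel, leaving [n(S) + h <= 2 n(S) <= n(S) e(S)]. *)
rewrite /extended_Wilf /Frobenius_number genusE; nia.
Qed.
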